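(* Let $I$ be a set that is not $\omega$-measurable. If $$\left( (A_i)_{i\in I}, (B_j)_{j\in J}, \varphi, ((A_{i,k})_{k\in\mathbb{N}})_{i\in I}, ((B_{j,k})_{k\in\mathbb{N}})_{j\in J}\right)$$ is a Chase system, then there are finite subsets $I'\subseteq I$ and $J'\subseteq J$ and a positive integer $n_0$ such that $$\varphi\Big( \prod_{i\in I\setminus I'} A_{i,n_0}\Big) \subseteq \bigoplus_{j\in J'} B_j + \bigcap_{n\in\mathbb{N}} \Big( \bigoplus_{j\in J} B_{j,n}\Big).$$
   Context: A Chase system is a tuple $( (A_i)_{i\in I}, (B_j)_{j\in J}, \varphi, ((A_{i,k})_{k\in\mathbb{N}})_{i\in I}, ((B_{j,k})_{k\in\mathbb{N}})_{j\in J})$ where: $(A_i)_{i\in I}$ and $(B_j)_{j\in J}$ are families of abelian groups; $\varphi:\prod_{i\in I}A_i\to\bigoplus_{j\in J}B_j$ is a homomorphism of abelian groups; for each $i\in I$, $(A_{i,k})_{k\in\mathbb{N}}$ is a descending family of subgroups of $A_i$; for each $j\in J$, $(B_{j,k})_{k\in\mathbb{N}}$ is a descending family of subgroups of $B_j$; and $\varphi(\prod_{i\in I}A_{i,k})\subseteq\bigoplus_{j\in J}B_{j,k}$ for all $k\in\mathbb{N}$. For a subset $T\subseteq I$, $\prod_{i\in T}A_{i,n}$ is viewed inside $\prod_{i\in I}A_i$ as the elements whose components outside $T$ are $0$; similarly for direct sums. A set $I$ (or its cardinal) is $\omega$-measurable if it is uncountable and there is a countably additive $\{0,1\}$-valued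 measure $\mu$ defined on all subsets of $I$ with $\mu(I)=1$ and $\mu(\{x\})=0$ for all $x\in I$. *)

(* Defs.v *)
From HB Require Import structures.
From mathcomp Require Import all_boot all_algebra.
From mathcomp Require Import all_classical all_reals.
From mathcomp Require Import ereal measure.

Set Implicit Arguments.
Unset Strict Implicit.
Unset Printing Implicit Defensive.

Import GRing.Theory.
Local Open Scope classical_set_scope.
Local Open Scope ring_scope.

(* An alias of [forall i, A i], so that its group structure does not overlap
   with the one MathComp-Analysis puts on non-dependent functions. *)
Definition dprod (I : Type) (A : I -> zmodType) : Type := forall i, A i.

Section DirectProduct.
Context {I : Type} (A : I -> zmodType).
Implicit Types x y z : dprod A.

HB.instance Definition _ := gen_eqMixin (dprod A).
HB.instance Definition _ := gen_choiceMixin (dprod A).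

Definition dprod_zero : dprod A := fun=> 0.
Definition dprod_add x y : dprod A := fun i => x i + y i.
Definition dprod_opp x : dprod A := fun i => - x i.

Fact dprod_addA : associative dprod_add.
Proof. by move=> x y z; apply: functional_extensionality_dep => i; apply: addrA. Qed.
Fact dprod_addC : commutative dprod_add.
Proof. by move=> x y; apply: functional_extensionality_dep => i; apply: addrC. Qed.
Fact dprod_add0 : left_id dprod_zero dprod_add.
Proof. by move=> x; apply: functional_extensionality_dep => i; apply: add0r. Qed.
Fact dprod_addN : left_inverse dprod_zero dprod_opp dprod_add.
Proof. by move=> x; apply: functional_extensionality_dep => i; apply: addNr. Qed.

HB.instance Definition _ := GRing.isZmodule.Build (dprod A)
  dprod_addA dprod_addC dprod_add0 dprod_addN.

Definition finsupp_pred : {pred dprod A} :=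
  fun x => `[< finite_set [set i | x i <> 0] >].

Fact finsupp_zmod_closed : zmod_closed finsupp_pred.
Proof.
split=> [|x y]; first by apply/asboolP; apply: (sub_finite_set _ (finite_set0 _)).
move=> /asboolP fx /asboolP fy; apply/asboolP.
have fxy : finite_set ([set i | x i <> 0] `|` [set i | y i <> 0]).
  by rewrite finite_setU.
apply: sub_finite_set fxy => i /= xy0.
have [xi0|] := pselect (x i = 0); last by left.
have [yi0|] := pselect (y i = 0); last by right.
by case: xy0; rewrite -[LHS]/(x i - y i) xi0 yi0 subrr.
Qed.
HB.instance Definition _ := GRing.isZmodClosed.Build (dprod A) finsupp_pred
  finsupp_zmod_closed.

Record dsum : Type := DSum {
  dsum_val :> dprod A;
  _ : dsum_val \in finsupp_pred }.

HB.instance Definition _ := [isSub for dsum_val].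
HB.instance Definition _ := [Choice of dsum by <:].
HB.instance Definition _ := [SubChoice_isSubZmodule of dsum by <:].

(* The subgroup prod_(i in T) S_i of the full product: components outside T
   vanish. *)
Definition prod_in (T : set I) (S : forall i, {pred A i}) : set (dprod A) :=
  [set x | forall i, (T i -> x i \in S i) /\ (~ T i -> x i = 0)].

Definition sum_in (T : set I) (S : forall i, {pred A i}) : set dsum :=
  [set y | prod_in T S y].

End DirectProduct.

Record chase_system (I J : Type) : Type := ChaseSystem {
  csA : I -> zmodType;
  csB : J -> zmodType;
  cs_phi : {additive dprod csA -> dsum csB};
  csA_fil : forall i : I, nat -> zmodClosed (csA i);
  csB_fil : forall j : J, nat -> zmodClosed (csB j);
  csA_desc : forall i k l, (k <= l)%N -> {subset csA_fil i l <= csA_fil i k};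
  csB_desc : forall j k l, (k <= l)%N -> {subset csB_fil j l <= csB_fil j k};
  cs_phi_fil : forall k,
    cs_phi @` prod_in setT (fun i => csA_fil i k)
      `<=` sum_in setT (fun j => csB_fil j k) }.

(* T with all its subsets measurable; the point x0 is only there because
   measurable types are pointed. *)
Definition discrete_space (T : Type) (x0 : T) : Type := T.

Section DiscreteSpace.
Context {T : Type} (x0 : T).
HB.instance Definition _ := gen_eqMixin (discrete_space x0).
HB.instance Definition _ := gen_choiceMixin (discrete_space x0).
HB.instance Definition _ :=
  isPointed.Build (discrete_space x0) (x0 : discrete_space x0).
HB.instance Definition _ := @isMeasurable.Build default_measure_display
  (discrete_space x0) discrete_measurable discrete_measurable0
  discrete_measurableC discrete_measurableU.
End DiscreteSpace.

(* The existence of x0 loses no generality: an uncountable type is inhabited. *)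
Definition omega_measurable (R : realType) (T : Type) : Prop :=
  ~ countable [set: T] /\
  exists (x0 : T) (mu : {measure set (discrete_space x0) -> \bar R}),
    [/\ forall X, mu X = 0%E \/ mu X = 1%E,
        mu [set: T] = 1%E &
        forall x : T, mu [set x] = 0%E].

(* Main.v *)
(* Call a subset T of I null if phi sends some step prod_(i in T) A_(i,n) into
   the required sum. Null sets form an ideal, and by a gliding hump argument
   every decreasing sequence of sets with empty intersection reaches a null set;
   hence the ideal is closed under countable unions, all but finitely many
   points are null, and every non-null set contains an atom modulo null sets.
   If the complement of the finite set of non-null points were not null, an
   atom inside it would carry a countably additive {0,1}-valued measure
   vanishing on points. *)
Require Import Defs.
From HB Require Import structures.
From mathcomp Require Import all_boot all_order all_algebra.
From mathcomp Require Import all_classical all_reals.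
From mathcomp Require Import ereal topology sequences measure.

Import Order.TTheory GRing.Theory Num.Theory.

Local Open Scope classical_set_scope.
Local Open Scope ring_scope.

(** * Ideals of null sets, without reference to groups *)

Record tail_ideal (T : Type) (N : set (set T)) : Prop := TailIdeal {
  tail_idealS : forall A B, A `<=` B -> N B -> N A;
  tail_idealU : forall A B, N A -> N B -> N (A `|` B);
  tail_ideal_tail : forall S : nat -> set T,
    (forall m, S m.+1 `<=` S m) -> \bigcap_m S m = set0 -> exists m, N (S m) }.

Lemma decreasing_le (T : Type) (S : nat -> set T) :
  (forall m, S m.+1 `<=` S m) -> forall m n, (m <= n)%N -> S n `<=` S m.
Proof.
move=> dS m n; elim: n => [|n IH]; first by rewrite leqn0 => /eqP ->.
by rewrite leq_eqVlt => /predU1P[-> //|/IH]; apply: subset_trans.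
Qed.

Lemma tail_ideal0 (T : Type) (N : set (set T)) : tail_ideal T N -> N set0.
Proof.
move=> idN; have [_||//] := tail_ideal_tail _ _ idN (fun=> set0).
- exact: subset_refl.
- by rewrite bigcap_const//; exists 0%N.
Qed.

(** The union minus its partial unions decreases to the empty set, so one of these differences is
    null, and so is the finite union it leaves out. *)
Lemma tail_ideal_bigcup (T : Type) (N : set (set T)) (A : nat -> set T) :
  tail_ideal T N -> (forall n, N (A n)) -> N (\bigcup_n A n).
Proof.
move=> idN NA.
have Nfin m : N (\bigcup_(k in `I_m) A k).
  elim: m => [|m IH]; first by rewrite II0 bigcup_set0; apply: tail_ideal0.
  by rewrite IISl bigcup_setU1; apply: tail_idealU.
have [m x||m Nm] := tail_ideal_tail _ _ idN
    (fun m => (\bigcup_n A n) `\` \bigcup_(k in `I_m) A k).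
- move=> [Ux nx]; split=> // -[k /= km Ak]; apply: nx; exists k => //=.
  exact: ltnW.
- rewrite -subset0 => x Sx; have [[k _ Ak] _] := Sx 0%N Logic.I.
  by have [_] := Sx k.+1 Logic.I; apply; exists k => /=.
- apply: (tail_idealS _ _ idN) (tail_idealU _ _ idN _ _ Nm (Nfin m)) => x Ux.
  by have [|] := pselect ((\bigcup_(k in `I_m) A k) x); [right|left].
Qed.

Lemma tail_ideal_countable (T : Type) (N : set (set T)) (D : set T) :
  tail_ideal T N -> countable D -> (forall x, D x -> N [set x]) -> N D.
Proof.
move=> idN /countable_injP[f injf] ND.
have NF n : N (D `&` f @^-1` [set n]).
  have [[x [Dx fx]]|nox] := pselect (exists x, D x /\ f x = n).
    apply: (tail_idealS _ _ idN) (ND x Dx) => y [Dy fy].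
    by apply: injf; rewrite ?inE// fx fy.
  apply: (tail_idealS _ _ idN) (tail_ideal0 _ _ idN) => y [Dy fy].
  by apply: nox; exists y.
apply: (tail_idealS _ _ idN) (tail_ideal_bigcup _ _ _ idN NF) => x Dx.
by exists (f x).
Qed.

(** Infinitely many non-null points would contain an injective sequence, whose tails decrease to the
    empty set although none of them is null. *)
Lemma tail_ideal_finite (T : Type) (N : set (set T)) :
  tail_ideal T N -> finite_set [set x | ~ N [set x]].
Proof.
move=> idN; apply: contrapT => /infiniteP/card_leP[f].
pose g k : T := val (f (to_setT k)).
have gN k : ~ N [set g k] by exact: set_valP (f (to_setT k)).
have g_inj : injective g.
  by move=> k l /val_inj/(inj (in_setT _) (in_setT _))/(congr1 val).
have [m||m Nm] := tail_ideal_tail _ _ idN (fun m => g @` [set k | (m <= k)%N]).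
- by apply: image_subset => k /=; apply: ltnW.
- rewrite -subset0 => x Sx; have [k _ gk] := Sx 0%N Logic.I.
  have [l /= kl gl] := Sx k.+1 Logic.I.
  have /g_inj lk : g l = g k by rewrite gl.
  by rewrite lk ltnn in kl.
- apply: (gN m); apply: (tail_idealS _ _ idN) Nm => _ ->.
  by exists m => /=.
Qed.

(** * Atoms and the measures they carry *)

Definition atom (T : Type) (N : set (set T)) (X : set T) : Prop :=
  ~ N X /\ forall Y, Y `<=` X -> N Y \/ N (X `\` Y).

(** Without an atom inside [X], every non-null subset splits into two non-null parts; iterating
    gives a decreasing sequence with non-null successive differences. *)
Lemma tail_ideal_atom (T : Type) (N : set (set T)) (X : set T) :
  tail_ideal T N -> ~ N X -> exists2 Y, Y `<=` X & atom T N Y.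
Proof.
move=> idN NX; apply: contrapT => noatom.
pose P (Y : set T) := Y `<=` X /\ ~ N Y.
have split_ (Y : {Y | P Y}) : {Z : {Z | P Z} |
    sval Z `<=` sval Y /\ ~ N (sval Y `\` sval Z)}.
  case: Y => Y [YX NY] /=; apply: cid.
  have : exists Z, [/\ Z `<=` Y, ~ N Z & ~ N (Y `\` Z)].
    apply: contrapT => noZ; apply: noatom; exists Y => //; split=> // Z ZY.
    have [|NZ] := pselect (N Z); first by left.
    by have [|NYZ] := pselect (N (Y `\` Z)); [right|case: noZ; exists Z].
  case=> Z [ZY NZ NYZ].
  by exists (exist _ Z (conj (subset_trans ZY YX) NZ)).
have [f [_ fP]] := dependent_choice split_
  (exist _ X (conj (@subset_refl _ X) NX)).
(* Removing the common intersection makes the sequence shrink to the empty set, while [S m] still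
   contains the difference of the sets at [m] and [m.+1]. *)
pose S m := sval (f m) `\` \bigcap_k sval (f k).
have [m x||m Nm] := tail_ideal_tail _ _ idN S.
- by move=> [fx nx]; split=> //; apply: (fP m).1.
- rewrite -subset0 => x Sx; have [_] := Sx 0%N Logic.I; apply=> k _.
  by have [] := Sx k Logic.I.
- apply: (fP m).2; apply: (tail_idealS _ _ idN) Nm => x [fx nfx].
  by split=> // nx; apply: nfx; apply: nx.
Qed.

(** A set has measure 1 exactly when its trace on [X] is non-null. Of disjoint sets at most one has
    this property, as [X] is an atom. *)
Lemma atom_omega_measurable (R : realType) (T : Type) (N : set (set T))
    (X : set T) :
  tail_ideal T N -> atom T N X -> (forall x, X x -> N [set x]) ->
  omega_measurable R T.
Proof.
move=> idN [NX atX] N1; split.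
  move=> cT; apply: NX; apply: tail_ideal_countable => //.
  by apply: sub_countable cT; apply: subset_card_le.
have [x0 _] : X !=set0.
  apply: contrapT => /set0P/negP; rewrite negbK => /eqP X0.
  by apply: NX; rewrite X0; apply: tail_ideal0.
pose mu (Y : set (discrete_space x0)) : \bar R :=
  if `[< N (Y `&` X) >] then 0%E else 1%E.
have muN Y : N (Y `&` X) -> mu Y = 0%E by rewrite /mu => /asboolT ->.
have muNN Y : ~ N (Y `&` X) -> mu Y = 1%E by rewrite /mu => /asboolF ->.
have mu0 : mu set0 = 0%E by apply: muN; rewrite set0I; apply: tail_ideal0.
have mu_ge0 Y : (0 <= mu Y)%E by rewrite /mu; case: ifP => //; rewrite lee01.
have mu_additive : semi_sigma_additive mu.
  move=> F _ tF _; have [[n nF]|NF] := pselect (exists n, ~ N (F n `&` X)).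
    rewrite muNN; last first.
      move=> NU; apply: nF; apply: (tail_idealS _ _ idN) NU.
      by apply: setSI => x Fx; exists n.
    (* Once the term [n] is included, the partial sums equal 1: any other [F k] meets [X] inside the
       complement of [F n], which is null by the atom property. *)
    apply: cvg_near_cst; exists n.+1 => // m /= nm.
    rewrite big_mkord (bigD1 (Ordinal nm))//= muNN// big1 ?adde0// => k kn.
    apply: muN; have [//|] := atX (F n `&` X) (@subIsetr _ _ _).
    apply: (tail_idealS _ _ idN) => x [Fkx Xx]; split=> // -[Fnx _].
    have kn' : (k : nat) = n by apply: tF => //; exists x.
    by move/eqP: kn; apply; apply/val_inj.
  have {}NF n : N (F n `&` X) by apply: contrapT => nF; apply: NF; exists n.
  rewrite muN; last by rewrite setI_bigcupl; apply: tail_ideal_bigcup.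
  by apply: cvg_near_cst; apply: nearW => m; rewrite big1// => k _; apply: muN.
pose M := isMeasure.Build _ _ R mu mu0 mu_ge0 mu_additive.
exists x0, (HB.pack mu M : {measure set (discrete_space x0) -> \bar R}).
split=> /=.
- by move=> Y; rewrite /mu; case: ifP; [left|right].
- by apply: muNN; rewrite setTI.
- move=> x; apply: muN; have [Xx|nXx] := pselect (X x).
    by apply: (tail_idealS _ _ idN) (N1 x Xx); apply: subIsetl.
  by apply: (tail_idealS _ _ idN) (tail_ideal0 _ _ idN) => y [-> /nXx].
Qed.

Lemma tail_ideal_cofinite (R : realType) (T : Type) (N : set (set T)) :
  ~ omega_measurable R T -> tail_ideal T N ->
  exists2 F : set T, finite_set F & N (~` F).
Proof.
move=> nmT idN; exists [set x | ~ N [set x]]; first exact: tail_ideal_finite.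
apply: contrapT => /(tail_ideal_atom _ _ _ idN)[X XF atX].
apply/nmT/(atom_omega_measurable _ _ _ _ idN atX) => x /XF /contrapT.
exact.
Qed.

(** * Coordinates and cutoffs *)

Lemma dsum_coordD (J : Type) (B : J -> zmodType) (y z : dsum B) (j : J) :
  dsum_val (y + z) j = dsum_val y j + dsum_val z j.
Proof. by []. Qed.

Lemma dsum_support_finite (J : Type) (B : J -> zmodType) (y : dsum B) :
  finite_set [set j | dsum_val y j <> 0].
Proof. by apply/asboolP; apply: (valP y). Qed.

Definition cutoff (I : Type) (A : I -> zmodType) (T : set I) (x : dprod A) :
  dprod A := fun i => if `[< T i >] then x i else 0.

Lemma cutoff_in (I : Type) (A : I -> zmodType) (S : forall i, zmodClosed (A i))
    (T : set I) (x : dprod A) :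
  (forall i, T i -> x i \in S i) -> prod_in T S (cutoff I A T x).
Proof.
move=> xS i; rewrite /cutoff; split=> Ti; last by rewrite asboolF.
by rewrite asboolT// xS.
Qed.

Lemma cutoff_decomp (I : Type) (A : I -> zmodType) (T : set I) (x : dprod A) :
  x = cutoff I A T x + cutoff I A (~` T) x.
Proof.
apply: functional_extensionality_dep => i.
rewrite -[RHS]/(cutoff I A T x i + cutoff I A (~` T) x i) /cutoff.
by rewrite asbool_neg; case: `[< T i >]; rewrite /= ?addr0 ?add0r.
Qed.

Lemma cutoff_finsupp (J : Type) (B : J -> zmodType) (T : set J) (y : dsum B) :
  cutoff J B T (dsum_val y) \in finsupp_pred (A := B).
Proof.
apply/asboolP; apply: sub_finite_set (dsum_support_finite J B y) => j /=.
by rewrite /cutoff; case: ifP.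
Qed.

(** * Null sets of a Chase system *)

Section ChaseSystem.
Context {I J : Type} (C : chase_system I J).
Let A := csA C.
Let B := csB C.
Let phi : {additive dprod A -> dsum B} := cs_phi C.
Let A_fil n := fun i => csA_fil C i n.

(** Membership in the required sum, read coordinatewise: [D] collects the finitely many coordinates
    left free. *)
Definition chase_null (T : set I) : Prop :=
  exists (D : set J) (n : nat), finite_set D /\
    forall x, prod_in T (A_fil n) x ->
      forall j m, ~ D j -> dsum_val (phi x) j \in csB_fil C j m.

Lemma csA_fil_le i m n (x : A i) :
  (m <= n)%N -> x \in csA_fil C i n -> x \in csA_fil C i m.
Proof. by move=> mn; apply: csA_desc. Qed.

Lemma csB_fil_le j m n (y : B j) :
  (m <= n)%N -> y \in csB_fil C j n -> y \in csB_fil C j m.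
Proof. by move=> mn; apply: csB_desc. Qed.

Lemma cs_phi_in n (x : dprod A) (j : J) :
  (forall i, x i \in csA_fil C i n) -> dsum_val (phi x) j \in csB_fil C j n.
Proof.
move=> xA; have [|+ _] := @cs_phi_fil _ _ C n (phi x) _ j; last exact.
by exists x => // i; split=> // -[].
Qed.

Lemma prod_in_fil T n (x : dprod A) (i : I) :
  prod_in T (A_fil n) x -> x i \in csA_fil C i n.
Proof.
move=> /(_ i)[xT x0]; have [/xT //|/x0 ->] := pselect (T i).
exact: rpred0.
Qed.

Lemma chase_nullS T T' : T `<=` T' -> chase_null T' -> chase_null T.
Proof.
move=> TT' [D [n [finD nullT']]]; exists D, n; split=> // x xT.
apply: nullT' => i; split=> [_|nT'i]; first exact: prod_in_fil xT.
by apply: (xT i).2 => /TT'.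
Qed.

Lemma chase_nullU T T' : chase_null T -> chase_null T' -> chase_null (T `|` T').
Proof.
move=> [D [n [finD nullT]]] [D' [n' [finD' nullT']]].
exists (D `|` D'), (maxn n n'); split=> [|x xU j m DD'].
  by rewrite finite_setU.
rewrite (cutoff_decomp _ _ T x) raddfD dsum_coordD; apply: rpredD.
  apply: nullT => [|Dj]; last by apply: DD'; left.
  apply: cutoff_in => i _; apply: csA_fil_le (prod_in_fil _ _ _ _ xU).
  exact: leq_maxl.
apply: nullT' => [|D'j]; last by apply: DD'; right.
move=> i; rewrite /cutoff; split=> [_|nT'i].
  case: ifP => _; last exact: rpred0.
  by apply: csA_fil_le (prod_in_fil _ _ _ _ xU); apply: leq_maxr.
(* Outside [T'], a point is either in [T], where the cutoff is 0, or outside the union, where [x] is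
   0. *)
case: asboolP => // nTi; apply: (xU i).2; by case.
Qed.

(* The elements [x k] of the gliding hump: the value at [j k] of the image of
   [\sum_l x l] is not cancelled, as the [x l] with [l < k] contribute [0] and
   those with [l > k] contribute an element of the filtration step that
   [phi (x k)] avoids. *)
Lemma gliding_hump (S : nat -> set I) (x : nat -> dprod A) (j : nat -> J)
    (N : nat -> nat) :
  (forall m, S m.+1 `<=` S m) -> \bigcap_m S m = set0 ->
  (forall k, prod_in (S k) (A_fil (N k)) (x k)) ->
  (forall k, (N k <= N k.+1)%N) ->
  (forall k, dsum_val (phi (x k)) (j k) \notin csB_fil C (j k) (N k.+1)) ->
  ~ (forall k l, (l < k)%N -> dsum_val (phi (x l)) (j k) = 0).
Proof.
move=> dS S0 xS leN xkN xl0.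
have [M MS] : {M : I -> nat & forall i, ~ S (M i) i}.
  apply: (@choice _ _ (fun i m => ~ S m i)) => i; apply: contrapT => Si.
  suff : (\bigcap_m S m) i by rewrite S0.
  by move=> m _; apply: contrapT => nS; apply: Si; exists m.
have x0 k i : (M i <= k)%N -> x k i = 0.
  by move=> Mk; apply: (xS k i).2 => /(decreasing_le _ _ dS _ _ Mk)/MS.
have homoN m n : (m <= n)%N -> (N m <= N n)%N.
  by apply: (homo_leq leqnn (@leq_trans)).
(* The infinite sum of the [x l] with [k <= l], finite in each coordinate since [x l i] vanishes
   from [l = M i] on. *)
pose y k : dprod A := fun i => \sum_(k <= l < M i) x l i.
have yS k : y k = x k + y k.+1.
  apply: functional_extensionality_dep => i.
  rewrite -[RHS]/(x k i + \sum_(k.+1 <= l < M i) x l i) /y.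
  have [kM|Mk] := ltnP k (M i); first by rewrite big_ltn.
  by rewrite x0// !big_geq ?addr0// ltnW.
have yA k i : y k i \in csA_fil C i (N k).
  rewrite /y big_seq; apply: rpred_sum => l; rewrite mem_index_iota => /andP[kl _].
  exact: csA_fil_le (homoN _ _ kl) (prod_in_fil _ _ _ _ (xS l)).
have y0 k : phi (y 0%N) = \sum_(l < k) phi (x l) + phi (y k).
  elim: k => [|k ->]; first by rewrite big_ord0 add0r.
  by rewrite big_ord_recr/= [in LHS]yS raddfD addrA.
have sum0 k : dsum_val (\sum_(l < k) phi (x l)) (j k) = 0.
  have : forall l : 'I_k, dsum_val (phi (x l)) (j k) = 0 by move=> l; apply: xl0.
  move=> e; elim/big_ind : _ => // u v u0 v0.
  by rewrite dsum_coordD u0 v0 addr0.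
have y0k k : dsum_val (phi (y 0%N)) (j k) <> 0.
  (* If this coordinate were 0, that of [phi (x k)] would be minus that of [phi (y k.+1)], hence in
     the step [N k.+1]. *)
  rewrite (y0 k) yS raddfD !dsum_coordD sum0 add0r => /eqP.
  rewrite addr_eq0 => /eqP e; apply/negP : (xkN k); rewrite e negbK rpredN.
  exact: cs_phi_in.
have j_inj : injective j.
  suff jlt k l : (l < k)%N -> j l <> j k.
    by move=> k l e; case: (ltngtP k l) => // /jlt; rewrite e.
  move=> lk e; have := xkN l.
  by move: (xl0 k l lk); rewrite -e => ->; rewrite rpred0.
(* The image of [y 0] would be nonzero at the infinitely many coordinates [j k]. *)
have : finite_set (j @^-1` [set i | dsum_val (phi (y 0%N)) i <> 0]).
  by apply: finite_preimage (dsum_support_finite _ _ _) => ? ? _ _ /j_inj.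
suff -> : j @^-1` [set i | dsum_val (phi (y 0%N)) i <> 0] = setT.
  exact: infinite_nat.
by apply/seteqP; split=> // k _; apply: y0k.
Qed.

Lemma chase_null_tail (S : nat -> set I) :
  (forall m, S m.+1 `<=` S m) -> \bigcap_m S m = set0 ->
  exists m, chase_null (S m).
Proof.
move=> dS S0; apply: contrapT => noS.
(* The recursion carries the current filtration step and a finite set of coordinates covering the
   supports of all earlier images. *)
pose state := (nat * {D : set J | finite_set D})%type.
have /choice[f fP] (p : nat * state) : exists q : dprod A * J * nat,
    [/\ prod_in (S p.1) (A_fil p.2.1) q.1.1, ~ sval p.2.2 q.1.2 &
      dsum_val (phi q.1.1) q.1.2 \notin csB_fil C q.1.2 q.2].
  case: p => k [n [D finD]]; apply: contrapT => noq.
  apply: noS; exists k, D, n; split=> // x xS j m nDj.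
  by apply/negPn/negP => xj; apply: noq; exists (x, j, m).
have finU (D : {D : set J | finite_set D}) (y : dsum B) :
    finite_set (sval D `|` [set j | dsum_val y j <> 0]).
  rewrite finite_setU; split; [exact: (svalP D)|exact: dsum_support_finite].
pose next k (s : state) : state :=
  let q := f (k, s) in (maxn s.1 q.2, exist _ _ (finU s.2 (phi q.1.1))).
pose st := fix st k : state :=
  if k is k'.+1 then next k' (st k') else (0%N, exist _ set0 (finite_set0 _)).
pose q k := f (k, st k).
apply: (gliding_hump S (fun k => (q k).1.1) (fun k => (q k).1.2)
  (fun k => (st k).1)) => //.
- by move=> k; have [] := fP (k, st k).
- by move=> k; apply: leq_maxl.
- move=> k; have [_ _] := fP (k, st k); apply: contra.
  by apply: csB_fil_le; apply: leq_maxr.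
- have mono k l : (l <= k)%N -> sval (st l).2 `<=` sval (st k).2.
    elim: k => [|k IH]; first by rewrite leqn0 => /eqP ->.
    rewrite leq_eqVlt => /predU1P[-> //|/IH sub] i /sub.
    by left.
  (* The support of the image chosen at stage [l] enters the set at stage [l.+1 <= k], and the
     coordinate chosen at stage [k] avoids that set. *)
  move=> k l lk; apply: contrapT => xlk; have [_ + _] := fP (k, st k).
  by apply; apply: (mono _ _ lk); right.
Qed.

Lemma chase_null_ideal : tail_ideal I chase_null.
Proof.
by split; [exact: chase_nullS|exact: chase_nullU|exact: chase_null_tail].
Qed.

End ChaseSystem.

Theorem lemma2p4 (R : realType) (I J : Type) (hI : ~ omega_measurable R I)
    (C : chase_system I J) :
  exists (I' : set I) (J' : set J) (n0 : nat),
    [/\ finite_set I', finite_set J', (0 < n0)%N &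
      cs_phi C @` prod_in (~` I') (fun i => csA_fil C i n0) `<=`
        [set b + c | b in sum_in J' (fun=> predT)
                   & c in \bigcap_(n in [set: nat])
                            sum_in [set: J] (fun j => csB_fil C j n)]].
Proof.
have [F finF [D [n [finD nullF]]]] :=
  tail_ideal_cofinite R I _ hI (chase_null_ideal C).
(* The successor makes the step positive; descent allows it. *)
exists F, D, n.+1; split=> // _ [x xF <-].
have {}nullF : forall j m, ~ D j -> dsum_val (cs_phi C x) j \in csB_fil C j m.
  apply: nullF => i; split=> [_|]; last exact: (xF i).2.
  exact: csA_fil_le (leqnSn n) (prod_in_fil _ _ _ _ _ xF).
(* The image splits into its coordinates in [D] and the others, which lie in every filtration
   step. *)
exists (DSum (cutoff_finsupp _ _ D (cs_phi C x))).
  by move=> j; rewrite /= /cutoff; split=> [//|nDj]; rewrite asboolF.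
exists (DSum (cutoff_finsupp _ _ (~` D) (cs_phi C x))).
  move=> m _ j; split=> [_|[]//]; rewrite /= /cutoff.
  case: asboolP => [Dj|_]; last exact: rpred0.
  exact: nullF.
by apply: val_inj; rewrite /= -cutoff_decomp.
Qed.
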